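(* Let $\mathcal{C}^\circ$ and $\widetilde{\mathcal{C}}^\circ$ be admissible parabolas of $\mathbb{L}$, the proper parts of the chains $\mathcal{C}$ and $\widetilde{\mathcal{C}}$, respectively. Let $L$ be an arbitrary non-vertical singular line. Then the chains $\mathcal{C}$ and $\widetilde{\mathcal{C}}$ have the same improper point if, and only if, the parallel projection of $\widetilde{\mathcal{C}}^\circ$ onto the plane of $\mathcal{C}^\circ$, in the direction of $L$, is a translate of $\mathcal{C}^\circ$.
   Context: Let $\mathbb{L}=\mathbb{R}[X]/\langle X^3\rangle$, a 3-dimensional commutative local real algebra with basis $1,\varepsilon,\varepsilon^2$, where $\varepsilon=X+\langle X^3\rangle$, so $\varepsilon^3=0$. Its maximal ideal is $N=\mathbb{R}\varepsilon+\mathbb{R}\varepsilon^2$, and $\mathbb{R}$ is regarded as a subring of $\mathbb{L}$. The projective line $\mathbb{P}(\mathbb{L})$ over $\mathbb{L}$ is the set of all cyclic submodules $\mathbb{L}(u,v)\subset\mathbb{L}^2$ such that $u$ or $v$ is a unit of $\mathbb{L}$. The real projective line $\mathbb{P}(\mathbb{R})$ is embedded in it by $\mathbb{R}(x,y)\mapsto\mathbb{L}(x,y)$. The chains are the images of $\mathbb{P}(\mathbb{R})\subset\mathbb{P}(\mathbb{L})$ under the natural right action of $\mathrm{GL}_2(\mathbb{L})$ on $\mathbb{L}^2$. A proper point of $\mathbb{P}(\mathbb{L})$ is one of the form $\mathbb{L}(z,1)$ with $z\in\mathbb{L}$, and it is identified with $z\in\mathbb{L}$. Every other point has the form $\mathbb{L}(1,z)$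 with $z\in N$ and is called improper. Each chain contains exactly one improper point. The proper part $\mathcal{C}^\circ$ of a chain $\mathcal{C}$ is the set of its proper points, regarded as a subset of the real affine 3-space $\mathbb{L}$. A line $\mathbb{R}u+v\subset\mathbb{L}$ ($u\in\mathbb{L}\setminus\{0\}$, $v\in\mathbb{L}$) is singular if $u\in N$; it is vertical if it is of the form $\mathbb{R}\varepsilon^2+v$. A parabola in $\mathbb{L}$ (lying in some affine plane of $\mathbb{L}$) is called admissible if it is the proper part of a chain. A translate of a set is its image under a translation of the affine space $\mathbb{L}$. *)

(* Defs.v *)
From HB Require Import structures.
From mathcomp Require Import all_boot all_order all_algebra.
From mathcomp Require Import boolp classical_sets reals.

Set Implicit Arguments.
Unset Strict Implicit.
Unset Printing Implicit Defensive.

Import Order.TTheory GRing.Theory Num.Theory.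
Local Open Scope ring_scope.
Local Open Scope classical_set_scope.

(* [{poly %/ h}] is the quotient by [mk_monic h]; see [mk_monic_X3]. *)
Notation dual3 R := {poly %/ ('X^3 : {poly R})}.

Lemma mk_monic_X3 (R : realType) : mk_monic ('X^3 : {poly R}) = 'X^3.
Proof. by rewrite /mk_monic size_polyXn monicXn. Qed.

Section DualThree.
Variable R : realType.
Local Notation L := (dual3 R).

Definition eps : L := 'qX.

Definition maxN : set L :=
  [set z | exists a b : R, z = a *: eps + b *: eps ^+ 2].

(* The projective line; points are cyclic submodules of L^2 (row vectors). *)

Definition pair_rV (u v : L) : 'rV[L]_2 :=
  \row_(j < 2) (if j == ord0 then u else v).

Definition cyclic_sub (u v : L) : set 'rV[L]_2 :=
  [set c *: pair_rV u v | c in [set: L]].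

Definition proj_line : set (set 'rV[L]_2) :=
  [set p | exists u v : L,
     (u \is a GRing.unit \/ v \is a GRing.unit) /\ p = cyclic_sub u v].

Definition real_proj_line : set (set 'rV[L]_2) :=
  [set p | exists x y : R,
     (x != 0 \/ y != 0) /\ p = cyclic_sub (x%:A) (y%:A)].

Definition is_chain (C : set (set 'rV[L]_2)) : Prop :=
  exists2 g : 'M[L]_2, g \in unitmx &
    C = [set [set w *m g | w in p] | p in real_proj_line].

Definition proper_part (C : set (set 'rV[L]_2)) : set L :=
  [set z | C (cyclic_sub z 1)].

Definition improper : set (set 'rV[L]_2) :=
  proj_line `\` [set cyclic_sub z 1 | z in [set: L]].

Definition has_improper_point (C : set (set 'rV[L]_2)) (p : set 'rV[L]_2) :
  Prop := C `&` improper = [set p].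

Definition same_improper_point (C C' : set (set 'rV[L]_2)) : Prop :=
  exists p, has_improper_point C p /\ has_improper_point C' p.

Definition line (u v : L) : set L := [set t *: u + v | t in [set: R]].

Definition singular_line (l : set L) : Prop :=
  exists u v : L, [/\ u != 0, maxN u & l = line u v].

Definition vertical_line (l : set L) : Prop :=
  exists v : L, l = line (eps ^+ 2) v.

Definition direction (l : set L) : set L :=
  [set x | exists y z, [/\ l y, l z & x = y - z]].

Definition is_plane (E : set L) : Prop :=
  exists o a b : L, free [:: a; b] /\
    E = [set x | exists s t : R, x = o + s *: a + t *: b].

(* A parabola is the affine image of {(s, s^2)}: it has the equation t = s^2
   in suitable affine coordinates (s, t) of its plane. *)
Definition is_parabola (S : set L) : Prop :=
  exists o a b : L, free [:: a; b] /\
    S = [set o + s *: a + s ^+ 2 *: b | s in [set: R]].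

Definition admissible_parabola (S : set L) : Prop :=
  is_parabola S /\ exists2 C, is_chain C & S = proper_part C.

(* All points where a parallel to l through a point of S meets E. *)
Definition parallel_projection (E l S : set L) : set L :=
  [set q | E q /\ exists2 p, S p & direction l (q - p)].

Definition is_translate (S T : set L) : Prop :=
  exists w : L, S = [set x + w | x in T].

End DualThree.

(* Main.v *)
Require Import Defs.
From mathcomp Require Import all_boot all_order all_algebra.
From mathcomp Require Import boolp classical_sets reals.
From mathcomp Require Import ring lra.
Local Open Scope ring_scope.
Local Open Scope classical_set_scope.

Import Order.TTheory GRing.Theory Num.Theory.

(** A chain is the set of points [L(x a + y c, x b + y d)], for real [x, y] not
    both zero, where [(a, b)] and [(c, d)] are the rows of an invertible matrix
    over [L].  Real row operations and a common unit factor do not change the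
    chain, and they bring the matrix to a form with [d = 1], with [b] in the
    maximal ideal and with [a] of real part 1 (lemma [chain_std]).  The only
    improper point is then the one with [y = 0], that is [L(a, b)], and the
    proper part is the curve [z(t) = (t a + c) / (1 + t b)].

    Write [b = b1 eps + b2 eps^2].  As [b^3 = 0], the curve is polynomial of
    degree at most 3 in [t].  If [b1 <> 0] it is a twisted cubic, which lies in
    no plane; if [b = 0] it is a line.  So the admissible parabolas have
    [b = b2 eps^2] with [b2 <> 0] (lemma [parabola_chain_vertical]), and they
    are the curves [c + t alpha - t^2 b2 eps^2] with [alpha] of real part 1.
    Two such chains have the same improper point exactly when the numbers [b2]
    agree (lemma [same_improper_point_vertical]).  So the improper point encodes
    the curvature of the parabola, measured against the parameter [t], which
    is the real part up to a shift.

    The plane of such a parabola contains the vertical direction [eps^2], and a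
    projection along a non-vertical singular line preserves the real part and
    fixes [eps^2].  It therefore maps a parabola of this kind to another one
    with the same [b2], lying in the target plane (lemma
    [parallel_projection_vparabola]).  Inside one plane, completing the square
    shows that two such parabolas are translates of each other exactly when
    their numbers [b2] agree (lemma [translate_vparabola]). *)

Section ChainsOverL.
Set Implicit Arguments.
Unset Strict Implicit.

Variable R : realType.
Local Notation L := (dual3 R).
Local Notation eps := (eps R).
Implicit Types (z w u v : L) (s t x y : R).

(** * The algebra in coordinates *)

(** The coordinate of [z] along [eps ^+ i], for [i < 3]. *)
Definition cf (z : L) (i : nat) : R := (z : {poly R})`_i.

Lemma cf_inj z w :
  cf z 0 = cf w 0 -> cf z 1 = cf w 1 -> cf z 2 = cf w 2 -> z = w.
Proof.
move=> e0 e1 e2; apply/npolyP => i.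
case: i => [|[|[|i]]] //.
by rewrite !big_coef_npoly // mk_monic_X3 size_polyXn.
Qed.

Lemma cf0 i : cf 0 i = 0.
Proof. by rewrite /cf coef0. Qed.

Lemma cf1 i : cf 1 i = (i == 0)%:R.
Proof. by rewrite /cf coef1. Qed.

Lemma cfD z w i : cf (z + w) i = cf z i + cf w i.
Proof. exact: coefD. Qed.

Lemma cfN z i : cf (- z) i = - cf z i.
Proof. exact: coefN. Qed.

Lemma cfZ t z i : cf (t *: z) i = t * cf z i.
Proof. exact: coefZ. Qed.

Lemma cf_eps i : cf eps i = (i == 1)%:R.
Proof. by rewrite /cf qpolyXE ?size_polyXn ?monicXn // coefX. Qed.

Lemma rmodp_X3 (p : {poly R}) :
  Pdiv.CommonRing.rmodp p (mk_monic 'X^3) = take_poly 3 p.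
Proof. by rewrite mk_monic_X3 Pdiv.RingMonic.take_poly_rmodp. Qed.

Lemma cfM z w i : (i < 3)%N ->
  cf (z * w) i = \sum_(j < i.+1) cf z j * cf w (i - j).
Proof.
by move=> i3; rewrite /cf poly_of_qpolyM rmodp_X3 coef_take_poly i3 coefM.
Qed.

Lemma cfM0 z w : cf (z * w) 0 = cf z 0 * cf w 0.
Proof. by rewrite cfM // big_ord1. Qed.

Lemma cfM1 z w : cf (z * w) 1 = cf z 0 * cf w 1 + cf z 1 * cf w 0.
Proof. by rewrite cfM // !big_ord_recl big_ord0 addr0. Qed.

Lemma cfM2 z w :
  cf (z * w) 2 = cf z 0 * cf w 2 + cf z 1 * cf w 1 + cf z 2 * cf w 0.
Proof. by rewrite cfM // !big_ord_recl big_ord0 addr0 addrA. Qed.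

Definition cfE := (cfD, cfN, cfZ, cfM0, cfM1, cfM2, cf1, cf0, cf_eps, expr2,
  eqxx, mulr1n, mulr0n).

(** The inverse of [cf]: the element with the three given coordinates. *)
Definition ofcf x y t : L := x%:A + y *: eps + t *: eps ^+ 2.

Lemma cf_ofcf0 x y t : cf (ofcf x y t) 0 = x.
Proof. by rewrite !cfE /=; ring. Qed.
Lemma cf_ofcf1 x y t : cf (ofcf x y t) 1 = y.
Proof. by rewrite !cfE /=; ring. Qed.
Lemma cf_ofcf2 x y t : cf (ofcf x y t) 2 = t.
Proof. by rewrite !cfE /=; ring. Qed.

(** An element with real part [z0 <> 0] is [z0 + n] with [n] nilpotent, so the
    geometric series for its inverse stops after the term in [n^2]. *)
Lemma unitL z : (z \is a GRing.unit) = (cf z 0 != 0).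
Proof.
apply/idP/idP => [zU|z0].
  have /(congr1 (cf^~ 0)) := mulrV zU; rewrite !cfE /= => e.
  by apply: contra_eq_neq e => ->; rewrite mul0r eq_sym oner_eq0.
apply/unitrPr.
exists (ofcf (cf z 0)^-1 (- cf z 1 / cf z 0 ^+ 2)
   (cf z 1 ^+ 2 / cf z 0 ^+ 3 - cf z 2 / cf z 0 ^+ 2)).
by apply: cf_inj; rewrite !(cfM0, cfM1, cfM2, cf_ofcf0, cf_ofcf1, cf_ofcf2)
  !cf1 /=; field.
Qed.

Lemma cf_inv0 u : u \is a GRing.unit -> cf u^-1 0 = (cf u 0)^-1.
Proof.
move=> uU; have /(congr1 (cf^~ 0)) := mulrV uU; rewrite cfM0 cf1 => e.
by rewrite unitL in uU; apply: (mulfI uU); rewrite e divff.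
Qed.

Lemma maxNP z : maxN z -> cf z 0 = 0.
Proof. by case=> a [b ->]; rewrite !cfE /=; ring. Qed.

(** * Points of the projective line *)

Lemma pair_rV_inj u v u' v' : pair_rV u v = pair_rV u' v' -> u = u' /\ v = v'.
Proof.
move=> /matrixP e; split.
  by have := e ord0 ord0; rewrite !mxE.
by have := e ord0 (lift ord0 ord0); rewrite !mxE.
Qed.

Lemma scale_pair_rV c u v : c *: pair_rV u v = pair_rV (c * u) (c * v).
Proof. by apply/matrixP => i j; rewrite !mxE; case: ifP. Qed.

Lemma mem_cyclic_sub u v : cyclic_sub u v (pair_rV u v).
Proof. by exists 1 => //; rewrite scale1r. Qed.

Lemma cyclic_sub_eqP u v u' v' : cyclic_sub u v = cyclic_sub u' v' ->
  exists c, u = c * u' /\ v = c * v'.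
Proof.
move=> e; have := mem_cyclic_sub u v; rewrite e => -[c _].
by rewrite scale_pair_rV => /pair_rV_inj[<- <-]; exists c.
Qed.

Lemma cyclic_subZ c u v : c \is a GRing.unit ->
  cyclic_sub (c * u) (c * v) = cyclic_sub u v.
Proof.
move=> cU; apply/seteqP; split => _ [d _ <-].
  by exists (d * c) => //; rewrite !scale_pair_rV !mulrA.
by exists (d / c) => //; rewrite !scale_pair_rV !mulrA divrK.
Qed.

Lemma cyclic_sub_proper z u v :
  cyclic_sub z 1 = cyclic_sub u v <-> v \is a GRing.unit /\ z * v = u.
Proof.
split=> [/cyclic_sub_eqP[c [-> e]]|[vU <-]].
  split; first by apply/unitrPr; exists c; rewrite mulrC.
  by rewrite mulrAC -e mul1r.
by rewrite -(cyclic_subZ z 1 vU) mulr1 mulrC.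
Qed.

Lemma cyclic_sub_eq_unit u v u' v' :
  u \is a GRing.unit -> u' \is a GRing.unit ->
  cyclic_sub u v = cyclic_sub u' v' <-> u * v' = u' * v.
Proof.
move=> uU u'U; split=> [/cyclic_sub_eqP[c [-> ->]]|e].
  by rewrite mulrCA mulrA.
have cU : u' / u \is a GRing.unit by rewrite unitrM unitrV u'U uU.
have eu : u' / u * u = u' by rewrite divrK.
rewrite -(cyclic_subZ u v cU) eu; congr cyclic_sub.
by apply: (mulrI uU); rewrite e mulrCA mulrA eu.
Qed.

Lemma cyclic_sub_mulmx (g : 'M[L]_2) u v :
  [set w *m g | w in cyclic_sub u v] =
  cyclic_sub (u * g ord0 ord0 + v * g ord_max ord0)
             (u * g ord0 ord_max + v * g ord_max ord_max).
Proof.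
have e : pair_rV u v *m g =
    pair_rV (u * g ord0 ord0 + v * g ord_max ord0)
            (u * g ord0 ord_max + v * g ord_max ord_max).
  apply/matrixP => i j; rewrite !mxE !big_ord_recl big_ord0 !mxE /= addr0.
  rewrite (_ : lift ord0 ord0 = ord_max); last exact: val_inj.
  case: ifPn => [/eqP -> //|j0].
  rewrite (_ : j = ord_max) //; apply: val_inj.
  by case: j j0 => -[|[|[]]].
apply/seteqP; split=> [_ [_ [c _ <-] <-]|_ [c _ <-]].
  by exists c => //; rewrite -scalemxAl e.
by exists (c *: pair_rV u v); [exists c | rewrite -scalemxAl e].
Qed.

(** * A normal form for chains *)

(** The image of the real line under the matrix with rows [(a, b)] and
    [(c, d)]; invertibility is not built in, so that row operations can be
    carried out freely. *)
Definition row_chain (a b c d : L) : set (set 'rV[L]_2) :=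
  [set p | exists x y : R, (x != 0 \/ y != 0) /\
    p = cyclic_sub (x *: a + y *: c) (x *: b + y *: d)].

Lemma det_mx22 (g : 'M[L]_2) : \det g =
  g ord0 ord0 * g ord_max ord_max - g ord0 ord_max * g ord_max ord0.
Proof.
rewrite (expand_det_row _ ord0) !big_ord_recl big_ord0 /cofactor !det_mx11 !mxE.
rewrite /= expr0 expr1 addr0 mul1r mulN1r mulrN.
by congr (_ * g _ _ - g _ _ * g _ _); apply: val_inj.
Qed.

Lemma chain_rows C : is_chain C ->
  exists a b c d, cf (a * d - b * c) 0 != 0 /\ C = row_chain a b c d.
Proof.
move=> [g]; rewrite unitmxE det_mx22 unitL => gU ->.
exists (g ord0 ord0), (g ord0 ord_max), (g ord_max ord0), (g ord_max ord_max).
split=> //; apply/seteqP; split=> [_ [_ [x [y [xy ->]]] <-]|_ [x [y [xy ->]]]].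
  by exists x, y; rewrite cyclic_sub_mulmx !mulr_algl.
exists (cyclic_sub x%:A y%:A); first by exists x, y.
by rewrite cyclic_sub_mulmx !mulr_algl.
Qed.

Lemma row_chain_sub (p q r s : R) a b c d : p * s - q * r != 0 ->
  row_chain (p *: a + q *: c) (p *: b + q *: d)
            (r *: a + s *: c) (r *: b + s *: d) `<=` row_chain a b c d.
Proof.
move=> D0 _ [x [y [xy ->]]]; exists (x * p + y * r), (x * q + y * s); split.
  apply/orP; rewrite -negb_and; apply/negP => /andP[/eqP e1 /eqP e2].
  have ex : x * (p * s - q * r) = 0.
    transitivity (s * (x * p + y * r) - r * (x * q + y * s)); first by ring.
    by rewrite e1 e2 !mulr0 subrr.
  have ey : y * (p * s - q * r) = 0.
    transitivity (p * (x * q + y * s) - q * (x * p + y * r)); first by ring.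
    by rewrite e1 e2 !mulr0 subrr.
  move/eqP: ex; rewrite mulf_eq0 (negPf D0) orbF => x0.
  move/eqP: ey; rewrite mulf_eq0 (negPf D0) orbF => y0.
  by case: xy; rewrite ?x0 ?y0.
by congr cyclic_sub; apply: cf_inj; rewrite !(cfD, cfZ); ring.
Qed.

(** An invertible real row operation only reparametrizes the real line.  Both
    inclusions are instances of [row_chain_sub], the second one for the inverse
    operation. *)
Lemma row_chain_lin (p q r s : R) a b c d : p * s - q * r != 0 ->
  row_chain (p *: a + q *: c) (p *: b + q *: d)
            (r *: a + s *: c) (r *: b + s *: d) = row_chain a b c d.
Proof.
move=> D0; apply/seteqP; split; first exact: row_chain_sub.
set D := p * s - q * r in D0.
have inv1 (e f : L) :
    e = (s / D) *: (p *: e + q *: f) + (- q / D) *: (r *: e + s *: f).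
  by rewrite /D in D0 *; apply: cf_inj; rewrite !(cfD, cfZ); field.
have inv2 (e f : L) :
    f = (- r / D) *: (p *: e + q *: f) + (p / D) *: (r *: e + s *: f).
  by rewrite /D in D0 *; apply: cf_inj; rewrite !(cfD, cfZ); field.
have D'0 : s / D * (p / D) - - q / D * (- r / D) != 0.
  have -> : s / D * (p / D) - - q / D * (- r / D) = D^-1.
    by rewrite /D in D0 *; field.
  by rewrite invr_eq0.
have := @row_chain_sub _ _ _ _ (p *: a + q *: c) (p *: b + q *: d)
  (r *: a + s *: c) (r *: b + s *: d) D'0.
by rewrite -(inv1 a c) -(inv1 b d) -(inv2 a c) -(inv2 b d).
Qed.

Lemma row_chainZ u a b c d : u \is a GRing.unit ->
  row_chain (u * a) (u * b) (u * c) (u * d) = row_chain a b c d.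
Proof.
move=> uU.
have e x y :
    cyclic_sub (x *: (u * a) + y *: (u * c)) (x *: (u * b) + y *: (u * d)) =
    cyclic_sub (x *: a + y *: c) (x *: b + y *: d).
  by rewrite -[RHS](cyclic_subZ _ _ uU) !mulrDr -!scalerAr.
by apply/seteqP; split=> _ [x [y [xy ->]]]; exists x, y; rewrite e.
Qed.

(** The real parts [b0, d0] of the second column are not both zero, so the
    combination [b0 (a, b) + d0 (c, d)] of the rows has the real part
    [b0^2 + d0^2 > 0] in its second entry and can serve as second row, while
    [d0 (a, b) - b0 (c, d)] has real part 0 there.  Dividing by the second
    entry of the new second row turns that entry into 1. *)
Lemma chain_std C : is_chain C ->
  exists a b c, [/\ cf a 0 = 1, cf b 0 = 0 & C = row_chain a b c 1].
Proof.
move=> /chain_rows[a [b [c [d [D0 ->]]]]].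
move: (D0); rewrite cfD cfN !cfM0 => {}D0.
set D := cf a 0 * _ - _ in D0.
pose S := cf b 0 ^+ 2 + cf d 0 ^+ 2.
have S0 : S != 0.
  rewrite /S paddr_eq0 ?sqr_ge0 // !sqrf_eq0; apply: contra_neqN D0.
  by rewrite /D => /andP[/eqP-> /eqP->]; ring.
(* This factor makes the real part of the upper left entry equal to 1. *)
pose m := S / D.
have detS : m * cf d 0 * cf d 0 - - m * cf b 0 * cf b 0 != 0.
  have -> : m * cf d 0 * cf d 0 - - m * cf b 0 * cf b 0 = m * S.
    by rewrite /S; ring.
  by rewrite /m !mulf_neq0 ?invr_neq0.
rewrite -(row_chain_lin _ _ _ _ detS).
set d' := cf b 0 *: b + cf d 0 *: d.
have d'0 : cf d' 0 = S by rewrite /d' cfD !cfZ /S; ring.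
have d'U : d' \is a GRing.unit by rewrite unitL d'0.
have d'VU : d'^-1 \is a GRing.unit by rewrite unitrV.
rewrite -(row_chainZ _ _ _ _ d'VU) mulVr //.
set a' := _ *: a + _; set b' := _ *: b + _; set c' := _ *: a + _.
exists (d'^-1 * a'), (d'^-1 * b'), (d'^-1 * c'); split=> //.
  rewrite cfM0 cf_inv0 // d'0 /a' cfD !cfZ /m.
  move: D0; rewrite /D => D0; field; exact/andP.
by rewrite cfM0 cf_inv0 // d'0 /b' cfD !cfZ; ring.
Qed.

Lemma proper_part_chain a b c : cf b 0 = 0 ->
  proper_part (row_chain a b c 1) =
  [set z | exists t, z * (1 + t *: b) = t *: a + c].
Proof.
move=> b0; apply/seteqP; split=> z.
  move=> [x [y [_ /cyclic_sub_proper[yU e]]]].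
  have y0 : y != 0.
    by move: yU; rewrite unitL cfD !cfZ b0 cf1 mulr0 add0r mulr1.
  exists (x / y); apply: (scalerI y0).
  rewrite scalerAr !scalerDr !scalerA [y * _]mulrC divfK //.
  by rewrite [y%:A + _]addrC e.
move=> [t e]; exists t, 1; split; first by right; exact: oner_neq0.
apply/cyclic_sub_proper; rewrite !scale1r addrC e; split=> //.
by rewrite unitL cfD cfZ b0 cf1 mulr0 addr0 oner_neq0.
Qed.

(** Since [b] is not a unit, the second entry of the point with parameters
    [x, y] is a unit as soon as [y <> 0]; only the point with [y = 0] is
    improper. *)
Lemma has_improper_point_chain a b c p : cf a 0 = 1 -> cf b 0 = 0 ->
  has_improper_point (row_chain a b c 1) p <-> p = cyclic_sub a b.
Proof.
move=> a0 b0; rewrite /has_improper_point.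
have -> : row_chain a b c 1 `&` improper (R := R) = [set cyclic_sub a b].
  apply/seteqP; split=> q.
    move=> [[x [y [xy ->]]] [_ nproper]] /=.
    have y0 : y = 0.
      apply/eqP/negP => /negP y0; apply: nproper.
      have vU : x *: b + y%:A \is a GRing.unit.
        by rewrite unitL cfD !cfZ b0 cf1 mulr0 add0r mulr1.
      exists ((x *: a + y *: c) / (x *: b + y%:A)); first by [].
      by apply/cyclic_sub_proper; rewrite divrK.
    have x0 : x != 0 by case: xy => //; rewrite y0 eqxx.
    rewrite y0 !scale0r !addr0 -(mulr_algl x a) -(mulr_algl x b) cyclic_subZ //.
    by rewrite unitL cfZ cf1 mulr1.
  move=> ->; split; last split.
  - exists 1, 0; rewrite !scale0r !addr0 !scale1r; split=> //.
    by left; exact: oner_neq0.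
  - by exists a, b; split=> //; left; rewrite unitL a0 oner_neq0.
  - move=> [z _ /cyclic_sub_proper[]]; by rewrite unitL b0 eqxx.
split=> [e|->] //.
by have : [set p] p by []; rewrite -e.
Qed.

Lemma same_improper_point_chain a b c a' b' c' :
  cf a 0 = 1 -> cf b 0 = 0 -> cf a' 0 = 1 -> cf b' 0 = 0 ->
  same_improper_point (row_chain a b c 1) (row_chain a' b' c' 1) <->
  a * b' = a' * b.
Proof.
move=> a0 b0 a'0 b'0.
have aU : a \is a GRing.unit by rewrite unitL a0 oner_neq0.
have a'U : a' \is a GRing.unit by rewrite unitL a'0 oner_neq0.
rewrite -cyclic_sub_eq_unit //; split=> [[p []]|e].
  by move=> /has_improper_point_chain -> // /has_improper_point_chain ->.
by exists (cyclic_sub a b); split; apply/has_improper_point_chain.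
Qed.

(** * Admissible parabolas *)

(** A parabola with vertical axis, where [r] is its curvature with respect to
    the parameter [t].  This parameter has a geometric meaning only if [a] is
    normalized, as in [cf a 0 = 1] below. *)
Definition vparabola (o a : L) (r : R) : set L :=
  [set o + t *: a + (r * t ^+ 2) *: eps ^+ 2 | t in [set: R]].

Lemma cf_vpoint o a r t :
  let z := o + t *: a + (r * t ^+ 2) *: eps ^+ 2 in
  [/\ cf z 0 = cf o 0 + t * cf a 0, cf z 1 = cf o 1 + t * cf a 1
    & cf z 2 = cf o 2 + t * cf a 2 + r * t ^+ 2].
Proof. by split; rewrite !cfE /=; ring. Qed.

(** With [b = b2 eps^2] one has [b^2 = 0] and [b z = z0 b] for every [z] of
    real part [z0], hence
    [(t a + c) (1 - t b) = c + t (a - c0 b) - t^2 b]. *)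
Lemma proper_part_vparabola a b c : cf a 0 = 1 -> cf b 0 = 0 -> cf b 1 = 0 ->
  proper_part (row_chain a b c 1) =
  vparabola c (a - cf c 0 *: b) (- cf b 2).
Proof.
move=> a0 b0 b1; rewrite proper_part_chain //.
have tU t : 1 + t *: b \is a GRing.unit.
  by rewrite unitL cfD cfZ b0 cf1 mulr0 addr0 oner_neq0.
have e t : (c + t *: (a - cf c 0 *: b) + (- cf b 2 * t ^+ 2) *: eps ^+ 2)
    * (1 + t *: b) = t *: a + c.
  by apply: cf_inj; rewrite !cfE /= ?a0 ?b0 ?b1; ring.
apply/seteqP; split=> z [t].
  by rewrite -e => /(mulIr (tU t)) ->; exists t.
by move=> _ <-; exists t.
Qed.

Lemma free_pairP (a b : L) : free [:: a; b] ->
  forall x y, x *: a + y *: b = 0 -> x = 0 /\ y = 0.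
Proof.
move=> /freeP fr x y e.
have := fr (fun i : 'I_2 => if i == ord0 then x else y).
rewrite !big_ord_recl big_ord0 /= addr0 => /(_ e) f.
by have := f ord0; have := f (lift ord0 ord0).
Qed.

Definition dot (n z : L) : R :=
  cf n 0 * cf z 0 + cf n 1 * cf z 1 + cf n 2 * cf z 2.

Definition cross (a b : L) : L :=
  ofcf (cf a 1 * cf b 2 - cf a 2 * cf b 1)
       (cf a 2 * cf b 0 - cf a 0 * cf b 2)
       (cf a 0 * cf b 1 - cf a 1 * cf b 0).

(** If [cross a b = 0] then [b_i a = a_i b] for every coordinate [i], which
    contradicts independence. *)
Lemma cross_neq0 a b : free [:: a; b] -> cross a b != 0.
Proof.
move=> /free_pairP fr; apply/eqP => n0.
have := congr1 (cf^~ 0) n0; rewrite cf_ofcf0 cf0 => n00.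
have := congr1 (cf^~ 1) n0; rewrite cf_ofcf1 cf0 => n01.
have := congr1 (cf^~ 2) n0; rewrite cf_ofcf2 cf0 => n02.
have ai i : (i < 3)%N -> cf a i = 0.
  move=> i3; have [] // := fr (cf b i) (- cf a i); last first.
    by move=> _ /eqP; rewrite oppr_eq0 => /eqP.
  by apply: cf_inj; rewrite !cfE; case: i i3 => [|[|[|//]]] _; lra.
have a0 : a = 0 by apply: cf_inj; rewrite ai ?cf0.
have [] := fr 1 0; first by rewrite a0 scaler0 scale0r addr0.
by move/eqP; rewrite oner_eq0.
Qed.

Lemma dot_cross_span o a b s t :
  dot (cross a b) (o + s *: a + t *: b) = dot (cross a b) o.
Proof.
rewrite /dot !(cf_ofcf0, cf_ofcf1, cf_ofcf2) !(cfD, cfZ); ring.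
Qed.

(** On a line, the second and the first differences of three points of the
    parabola are multiples of the same vector [a], whereas they are [2 q] and
    [2 p] with [p] and [q] independent. *)
Lemma parabola_not_in_line o p q c a : free [:: p; q] ->
  ~ [set o + s *: p + s ^+ 2 *: q | s in [set: R]] `<=` line a c.
Proof.
move=> fr sub.
have pt s : exists t, o + s *: p + s ^+ 2 *: q = t *: a + c.
  by have [|t _ <-] := sub (o + s *: p + s ^+ 2 *: q); [exists s|exists t].
have [t0 e0] := pt 0; have [t1 e1] := pt 1; have [t2 e2] := pt (-1).
have pq i : (cf p i = (t1 - t2) / 2 * cf a i) *
            (cf q i = (t1 + t2 - 2 * t0) / 2 * cf a i).
  have := congr1 (cf^~ i) e0; have := congr1 (cf^~ i) e1.
  have := congr1 (cf^~ i) e2; rewrite !(cfD, cfZ) => h2 h1 h0.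
  by split; lra.
have [] := free_pairP fr (x := t1 + t2 - 2 * t0) (y := - (t1 - t2)).
  by apply: cf_inj; rewrite !(cfD, cfZ, cf0) !pq; ring.
move=> _ /eqP; rewrite oppr_eq0 => /eqP t12.
have p0 : p = 0 by apply: cf_inj; rewrite pq t12 cf0 !mul0r.
have [] := free_pairP fr (x := 1) (y := 0).
  by rewrite p0 scaler0 scale0r addr0.
by move/eqP; rewrite oner_eq0.
Qed.

(** The three coordinates of [z(t) = (t a + c) (1 - t b + t^2 b^2)] are
    polynomials in [t] whose leading terms are [t], [- b1 t^2] and
    [b1^2 t^3].  If [b1 <> 0], a linear form that is constant on this curve has
    to vanish: its coefficients are eliminated from the top degree downwards. *)
Lemma chain_planar a b c o p q : cf a 0 = 1 -> cf b 0 = 0 ->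
  free [:: p; q] ->
  proper_part (row_chain a b c 1) `<=`
    [set z | exists s t, z = o + s *: p + t *: q] ->
  cf b 1 = 0.
Proof.
move=> a0 b0 fr; rewrite proper_part_chain // => sub.
apply/eqP/negP => /negP b1.
pose n := cross p q.
pose z t := (t *: a + c) * (1 - t *: b + t ^+ 2 *: (b * b)).
have zP t : exists t', z t * (1 + t' *: b) = t' *: a + c.
  by exists t; apply: cf_inj; rewrite /z !cfE /= ?a0 ?b0; ring.
have z0 t : cf (z t) 0 = t + cf c 0.
  by rewrite /z !cfE /= a0 b0; ring.
have z1 t : cf (z t) 1 = t * cf a 1 + cf c 1 - t * cf b 1 * (t + cf c 0).
  by rewrite /z !cfE /= a0 b0; ring.
have z2 t : cf (z t) 2 =
    t * cf a 2 + cf c 2 - t * cf b 1 * (t * cf a 1 + cf c 1)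
    + (t ^+ 2 * cf b 1 ^+ 2 - t * cf b 2) * (t + cf c 0).
  by rewrite /z !cfE /= a0 b0; ring.
have zE t : dot n (z t) = dot n o.
  by have [s [r ->]] := sub _ (zP t); exact: dot_cross_span.
(* Four values determine a cubic polynomial; the combinations of them that give
   the coefficients are found by linear arithmetic. *)
move: (zE 0) (zE 1) (zE (-1)) (zE 2).
move: (dot n o) => k; rewrite /dot !z0 !z1 !z2.
have /eqP := cross_neq0 fr; rewrite -/n; clearbody n => nn0.
clear zE zP z0 z1 z2 z sub.
move: (cf b 1) b1 => b1 b1_neq0 h0 h1 hm h2.
have n2 : cf n 2 = 0.
  have : cf n 2 * b1 ^+ 2 = 0 by lra.
  by move/eqP; rewrite mulf_eq0 sqrf_eq0 (negPf b1_neq0) orbF => /eqP.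
rewrite n2 in h0 h1 hm h2.
have n1 : cf n 1 = 0.
  have : cf n 1 * b1 = 0 by lra.
  by move/eqP; rewrite mulf_eq0 (negPf b1_neq0) orbF => /eqP.
rewrite n1 in h0 h1 hm h2.
have n0 : cf n 0 = 0 by lra.
by apply: nn0; apply: cf_inj; rewrite cf0.
Qed.

(** The axis of every admissible parabola is vertical: otherwise the proper part
    of the chain is a twisted cubic or, for [b = 0], a line. *)
Lemma parabola_chain_vertical a b c : cf a 0 = 1 -> cf b 0 = 0 ->
  is_parabola (proper_part (row_chain a b c 1)) -> cf b 1 = 0 /\ cf b 2 != 0.
Proof.
move=> a0 b0 [o [p [q [fr E]]]].
have b1 : cf b 1 = 0.
  apply: (@chain_planar a b c o p q) => //.
  by rewrite E => _ [s _ <-]; exists s, (s ^+ 2).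
split=> //; apply/eqP => b2.
have b00 : b = 0 by apply: cf_inj; rewrite ?cf0.
apply: (@parabola_not_in_line o p q c a) => //.
rewrite -E proper_part_vparabola // => _ [t _ <-]; exists t => //.
by rewrite b2 b00 oppr0 mul0r scaler0 subr0 scale0r addr0 addrC.
Qed.

Lemma same_improper_point_vertical a b c a' b' c' :
  cf a 0 = 1 -> cf b 0 = 0 -> cf b 1 = 0 ->
  cf a' 0 = 1 -> cf b' 0 = 0 -> cf b' 1 = 0 ->
  same_improper_point (row_chain a b c 1) (row_chain a' b' c' 1) <->
  cf b' 2 = cf b 2.
Proof.
move=> a0 b0 b1 a'0 b'0 b'1; rewrite same_improper_point_chain //.
split=> [/(congr1 (cf^~ 2))|e].
  by rewrite !cfM2 a0 a'0 b0 b1 b'0 b'1 !mulr0 !addr0 !mul1r.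
by apply: cf_inj; rewrite ?cfM0 ?cfM1 ?cfM2 a0 a'0 b0 ?b1 b'0 ?b'1 ?e;
  rewrite ?mulr0 ?mul1r ?mul0r.
Qed.

(** * Projections and translations of vertical parabolas *)

(** A normal vector [n] of the plane is orthogonal to the directions [eps^2] and
    [a] of the parabola, which determines it up to a factor: [n2 = 0] and
    [n0 = - a1 n1]. *)
Lemma plane_vparabola E o a r : cf a 0 = 1 -> r != 0 -> is_plane E ->
  vparabola o a r `<=` E ->
  E = [set z | cf z 1 = cf o 1 + cf a 1 * (cf z 0 - cf o 0)].
Proof.
move=> a0 r0 [e [p [q [fr ->]]]] sub.
pose n := cross p q.
have nE t : dot n (o + t *: a + (r * t ^+ 2) *: eps ^+ 2) = dot n e.
  have [|x [y ->]] := sub (o + t *: a + (r * t ^+ 2) *: eps ^+ 2).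
    by exists t.
  exact: dot_cross_span.
have dE z : dot n z =
    cf n 0 * cf z 0 + cf n 1 * cf z 1 + cf n 2 * cf z 2 by [].
have nt t : cf n 0 * (cf o 0 + t) + cf n 1 * (cf o 1 + t * cf a 1) +
    cf n 2 * (cf o 2 + t * cf a 2 + r * t ^+ 2) = dot n e.
  by rewrite -(nE t) dE; have [-> -> ->] := cf_vpoint o a r t; rewrite a0 mulr1.
have h0 := nt 0; have h1 := nt 1; have h2 := nt (-1).
have n2 : cf n 2 = 0.
  have : cf n 2 * r = 0 by lra.
  by move/eqP; rewrite mulf_eq0 (negPf r0) orbF => /eqP.
rewrite n2 in h0 h1 h2.
have n0 : cf n 0 = - (cf n 1 * cf a 1) by lra.
have n1 : cf n 1 != 0.
  apply/eqP => n1; have /eqP := cross_neq0 fr; apply; rewrite -/n.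
  by apply: cf_inj; rewrite cf0 // n0 n1 mul0r oppr0.
apply/seteqP; split=> z /=.
  move=> [x [y ez]]; have := dot_cross_span e p q x y.
  rewrite -ez -/n -h0 dE n2 n0 => h.
  by apply: (mulfI n1); lra.
move=> z1.
have dz : dot n (z - e) = 0.
  have : dot n z = dot n e by rewrite -h0 !dE n2 n0 z1; ring.
  by rewrite !dE !(cfD, cfN) => h; lra.
(* The coefficients of [z - e] along [p] and [q] come from Cramer's rule in the
   coordinates 0 and 2, whose minor is [n1]. *)
have n1E : cf n 1 = cf p 2 * cf q 0 - cf p 0 * cf q 2 by rewrite cf_ofcf1.
exists ((cf (z - e) 2 * cf q 0 - cf (z - e) 0 * cf q 2) / cf n 1).
exists ((cf p 2 * cf (z - e) 0 - cf p 0 * cf (z - e) 2) / cf n 1).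
suff ->: z = e + (z - e); last by rewrite addrC subrK.
rewrite [e + _ - e]addrC addKr -addrA; congr (e + _).
move: (z - e) dz => w; rewrite dE => dw.
rewrite n1E in n1 *.
apply: cf_inj; rewrite !(cfD, cfZ); last first.
- by field.
- have : (cf p 2 * cf q 0 - cf p 0 * cf q 2) * cf w 1 =
     - cf n 0 * cf w 0 - cf n 2 * cf w 2 by rewrite -n1E; lra.
  rewrite cf_ofcf0 cf_ofcf2 => h.
  by apply: (mulfI n1); rewrite h; field.
- by field.
Qed.

(** A singular direction has real part 0, and it is non-vertical exactly if its
    middle coordinate does not vanish, so that it can be scaled to 1. *)
Lemma singular_direction l : singular_line l -> ~ vertical_line l ->
  exists u, [/\ cf u 0 = 0, cf u 1 = 1 &
    direction l = [set t *: u | t in [set: R]]].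
Proof.
move=> [u [v [u0 uN ->]]] nv.
have cu0 := maxNP uN.
have cu1 : cf u 1 != 0.
  apply/eqP => cu1; apply: nv; exists v.
  have ue : u = cf u 2 *: eps ^+ 2.
    by apply: cf_inj; rewrite !cfE /= ?cu0 ?cu1; ring.
  have cu2 : cf u 2 != 0.
    by apply: contra_neq u0 => cu2; rewrite ue cu2 scale0r.
  apply/seteqP; split=> _ [t _ <-].
    by exists (t * cf u 2) => //; rewrite -scalerA -ue.
  by exists (t / cf u 2) => //; rewrite {2}ue scalerA divfK.
exists ((cf u 1)^-1 *: u); split; first by rewrite cfZ cu0 mulr0.
  by rewrite cfZ mulVf.
apply/seteqP; split=> z.
  move=> [_ [_ [[t _ <-] [s _ <-] ->]]]; exists ((t - s) * cf u 1) => //.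
  by rewrite scalerA mulfK // scalerBl opprD addrACA subrr addr0.
move=> [t _ <-]; exists (t *: ((cf u 1)^-1 *: u) + v), v.
split; last by rewrite addrK.
  by exists (t / cf u 1) => //; rewrite scalerA.
by exists 0 => //; rewrite scale0r add0r.
Qed.

(** The projection adds to a point [z] the multiple of [u] which brings it into
    the plane; because of [u0 = 0] and [u1 = 1] the factor is
    [y + k (z0 - x) - z1].  This depends on [z0] and [z1] only, hence is an
    affine function of [t] along the parabola: the quadratic term is
    untouched. *)
Lemma parallel_projection_vparabola l u (x y k : R) o a r :
  direction l = [set t *: u | t in [set: R]] -> cf u 0 = 0 -> cf u 1 = 1 ->
  cf a 0 = 1 ->
  parallel_projection [set z | cf z 1 = y + k * (cf z 0 - x)] l
    (vparabola o a r) =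
  vparabola (o + (y + k * (cf o 0 - x) - cf o 1) *: u)
            (a + (k - cf a 1) *: u) r.
Proof.
move=> dl u0 u1 a0.
pose z t := o + t *: a + (r * t ^+ 2) *: eps ^+ 2.
pose h t := y + k * (cf (z t) 0 - x) - cf (z t) 1.
have zh t : z t + h t *: u =
    o + (y + k * (cf o 0 - x) - cf o 1) *: u +
    t *: (a + (k - cf a 1) *: u) + (r * t ^+ 2) *: eps ^+ 2.
  rewrite /h; have [-> -> _] := cf_vpoint o a r t; rewrite /z a0.
  move: (eps ^+ 2) => e.
  by apply: cf_inj; rewrite !(cfD, cfZ); ring.
apply/seteqP; split=> q.
  move=> [/= qE [_ [t _ <-]]]; rewrite dl => -[s _ es]; exists t => //.
  rewrite -zh; move: es; rewrite -/(z t) => es.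
  have eq : q = z t + s *: u by rewrite es addrC subrK.
  suff -> : h t = s by [].
  by move: qE; rewrite eq !(cfD (z t)) !(cfZ s) u0 u1 /h => qE; lra.
move=> [t _ <-]; rewrite -zh; split=> /=.
  by rewrite !(cfD (z t)) !(cfZ (h t)) u0 u1 /h; ring.
exists (z t); first by exists t.
by rewrite dl; exists (h t) => //; rewrite addrC addKr.
Qed.

(** The real part identifies the parameters of two translates up to a shift,
    and comparing coefficients gives one direction.  Conversely, with equal
    [r], the two tangent vectors [a] and [a'] differ by a vertical vector, which
    a shift of the parameter absorbs. *)
Lemma translate_vparabola o a r o' a' r' :
  cf a 0 = 1 -> cf a' 0 = 1 -> r != 0 ->
  is_translate (vparabola o' a' r') (vparabola o a r) <->
  cf a' 1 = cf a 1 /\ r' = r.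
Proof.
move=> a0 a'0 r0; split=> [[w E]|[a1 ->]].
  have pt t : exists s, [/\ cf o' 0 + t = cf o 0 + s + cf w 0,
      cf o' 1 + t * cf a' 1 = cf o 1 + s * cf a 1 + cf w 1 &
      cf o' 2 + t * cf a' 2 + r' * t ^+ 2 =
      cf o 2 + s * cf a 2 + r * s ^+ 2 + cf w 2].
    have : vparabola o' a' r' (o' + t *: a' + (r' * t ^+ 2) *: eps ^+ 2).
      by exists t.
    rewrite E => -[_ [s _ <-] e]; exists s.
    have [d0 d1 d2] := cf_vpoint o a r s.
    have [d'0 d'1 d'2] := cf_vpoint o' a' r' t.
    rewrite a0 a'0 !mulr1 in d0 d'0.
    by rewrite -d'0 -d'1 -d'2 -d0 -d1 -d2 -e !cfD.
  have [s [p0 p1 p2]] := pt 0.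
  have [s1 [q0 q1 q2]] := pt 1; have [s2 [m0 m1 m2]] := pt (-1).
  have e1 : s1 = s + 1 by lra.
  have e2 : s2 = s - 1 by lra.
  by rewrite e1 e2 in q1 q2 m1 m2; split; lra.
(* Completing the square: the shift [h] changes the linear term by [2 r h]. *)
pose h := (cf a' 2 - cf a 2) / (2 * r).
have h2 : cf a' 2 = cf a 2 + 2 * r * h by rewrite /h; field.
clearbody h.
pose w := o' - o - h *: a - (r * h ^+ 2) *: eps ^+ 2.
have e t : o' + t *: a' + (r * t ^+ 2) *: eps ^+ 2 =
    o + (t + h) *: a + (r * (t + h) ^+ 2) *: eps ^+ 2 + w.
  by apply: cf_inj; rewrite /w !cfE /= ?a0 ?a'0 ?a1 ?h2; ring.
exists w; apply/seteqP; split=> z.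
  move=> [t _ <-]; rewrite e; eexists; last by reflexivity.
  by exists (t + h).
move=> [_ [t _ <-] <-]; exists (t - h) => //.
by rewrite e subrK.
Qed.
End ChainsOverL.

Theorem theorem3 (R : realType) (C C' : set (set 'rV[dual3 R]_2))
    (E l : set (dual3 R)) :
  is_chain C -> is_chain C' ->
  admissible_parabola (proper_part C) ->
  admissible_parabola (proper_part C') ->
  is_plane E -> proper_part C `<=` E ->
  singular_line l -> ~ vertical_line l ->
  same_improper_point C C' <->
  is_translate (parallel_projection E l (proper_part C')) (proper_part C).
Proof.
move=> /chain_std[a [b [c [a0 b0 ->]]]] /chain_std[a' [b' [c' [a'0 b'0 ->]]]].
move=> [/(parabola_chain_vertical a0 b0)[b1 b2] _].
move=> [/(parabola_chain_vertical a'0 b'0)[b'1 b'2] _].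
rewrite !proper_part_vparabola // => planeE subE singl nvertl.
have [u [u0 u1 dl]] := singular_direction singl nvertl.
have alpha0 : cf (a - cf c 0 *: b) 0 = 1.
  by rewrite cfD cfN cfZ b0 mulr0 subr0.
have alpha'0 : cf (a' - cf c' 0 *: b') 0 = 1.
  by rewrite cfD cfN cfZ b'0 mulr0 subr0.
have nb2 : - cf b 2 != 0 by rewrite oppr_eq0.
rewrite (plane_vparabola alpha0 nb2 planeE subE).
rewrite (parallel_projection_vparabola _ _ _ _ _ dl u0 u1 alpha'0).
rewrite same_improper_point_vertical //.
rewrite translate_vparabola //; last by rewrite cfD cfZ u0 mulr0 addr0.
split=> [->|[_ /oppr_inj //]].
by split=> //; rewrite cfD cfZ u1 mulr1 addrC subrK.
Qed.
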